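(* Let $X$ be an $\omega$-well-filtered coherent $d$-space. If the product space $X\times X$ is a sequential space, then $X$ is sober.
   Context: The specialization order on a $T_0$ space $X$ is $x\le y \iff x\in\overline{\{y\}}$. A subset is saturated if it is an upper set in the specialization order (equivalently, an intersection of open sets). A poset is a dcpo if every directed subset (nonempty, any two elements have an upper bound in the subset) has a supremum. A subset $U$ of a poset $P$ is Scott open if it is an upper set and, for each directed $D\subseteq P$ whose supremum exists, $\bigvee D\in U$ implies $D\cap U\neq\emptyset$. A ($T_0$) space $X$ is a $d$-space if $X$ is a dcpo in its specialization order and every open set of $X$ is Scott open with respect to that order. A nonempty family $\mathcal F$ of sets is filtered if any two members contain a common member of $\mathcal F$. $X$ is $\omega$-well-filtered if for each countable filtered family $\mathcal F$ of compact saturated subsets of $X$ and each open $U\subseteq X$, $\bigcap\mathcal F\subseteq U$ implies $F\subseteq U$ for some $F\in\mathcal F$. $X$ is coherent if the intersection of any two compact saturated subsets of $X$ is compact (possibly empty). A nonempty subset $F$ of $X$ is irreducible if for closed $A,B\subseteq X$, $F\subseteq A\cup B$ implies $F\subseteq A$ or $F\subseteq B$. $X$ is sober if for every irreducible closed set $A$ there is a unique $x\in X$ with $A=\overline{\{x\}}$. A subset $A$ of a space $Y$ is sequentially closed if whenever a sequence in $A$ converges to $y\in Y$, then $y\in A$. $Y$ is a sequential space if every sequentially closed subset is closed. *)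

(* Defs.v *)
From mathcomp Require Import all_boot all_classical all_analysis.

Set Implicit Arguments.
Unset Strict Implicit.
Unset Printing Implicit Defensive.

Local Open Scope classical_set_scope.

Section OrderNotions.
Context {P : Type} (le : P -> P -> Prop).

Definition upper_set (U : set P) := forall x y, U x -> le x y -> U y.

Definition directed (D : set P) :=
  D !=set0 /\
  forall x y, D x -> D y -> exists z, [/\ D z, le x z & le y z].

Definition is_sup (D : set P) (s : P) :=
  (forall x, D x -> le x s) /\
  forall b, (forall x, D x -> le x b) -> le s b.

Definition dcpo := forall D : set P, directed D -> exists s, is_sup D s.

Definition Scott_open (U : set P) :=
  upper_set U /\
  forall (D : set P) (s : P),
    directed D -> is_sup D s -> U s -> D `&` U !=set0.

End OrderNotions.

Section SpaceNotions.
Context (X : topologicalType).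

Definition specialization (x y : X) := closure [set y] x.

Definition saturated (A : set X) := upper_set specialization A.

(* Kolmogorov's axiom makes the specialization preorder antisymmetric, so that
   [dcpo] and [Scott_open] below are applied to a partial order. *)
Definition d_space :=
  [/\ kolmogorov_space X,
      dcpo specialization &
      forall U : set X, open U -> Scott_open specialization U].

Definition compact_saturated (K : set X) := compact K /\ saturated K.

Definition coherent :=
  forall K L : set X, compact_saturated K -> compact_saturated L ->
    compact (K `&` L).

Definition filtered_family (F : set (set X)) :=
  F !=set0 /\
  forall A B, F A -> F B -> exists C, [/\ F C, C `<=` A & C `<=` B].

Definition omega_well_filtered :=
  forall F : set (set X),
    countable F -> filtered_family F -> F `<=` compact_saturated ->
    forall U : set X, open U ->
      \bigcap_(K in F) K `<=` U -> exists2 K, F K & K `<=` U.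

Definition irreducible (F : set X) :=
  F !=set0 /\
  forall A B : set X, closed A -> closed B ->
    F `<=` A `|` B -> F `<=` A \/ F `<=` B.

Definition sober :=
  forall A : set X, closed A -> irreducible A ->
    exists! x, A = closure [set x].

Definition sequentially_closed (A : set X) :=
  forall (u : nat -> X) (y : X),
    (forall n, A (u n)) -> u @ \oo --> y -> A y.

Definition sequential_space :=
  forall A : set X, sequentially_closed A -> closed A.

End SpaceNotions.

(* Main.v *)
Require Import Defs.
From mathcomp Require Import all_boot all_classical all_analysis.

(** In a d-space a closed directed set is the closure of its supremum, so it
    suffices that an irreducible closed set [A] is directed.  The set [W] of the
    pairs [(a, b)] with [up a `&` up b `<=` ~` A] is open in [X * X]: if
    [(a_n, b_n)] converges to [(a, b)] in [W], the saturations [K_n] and [L_n] of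
    the tails (limit included) are compact with intersections [up a] and [up b],
    so coherence and omega-well-filteredness give [K_n `&` L_n `<=` ~` A] for
    some [n].  If [x, y] in [A] had no common upper bound in [A], then [(x, y)]
    would have an open box [V1 `*` V2 `<=` W]; irreducibility gives [z] in
    [A `&` V1 `&` V2], and [(z, z)] in [W] contradicts [A z]. *)

Set Implicit Arguments.
Unset Strict Implicit.
Unset Printing Implicit Defensive.

Local Open Scope classical_set_scope.

Section Specialization.
Context (X : topologicalType).
Implicit Types (x y z a : X) (A U V : set X) (u : nat -> X).

Lemma specialization_nbhs x y V : specialization x y -> nbhs x V -> V y.
Proof. by move=> xy /xy [_ [-> ]]. Qed.

Lemma specializationP x y :
  specialization x y <-> forall V, open V -> V x -> V y.
Proof.
split=> [xy V oV Vx|h B /nbhs_interior nB].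
  exact: specialization_nbhs xy (open_nbhs_nbhs (conj oV Vx)).
exists y; split=> //; apply: (@interior_subset _ B).
by apply: h; [exact: open_interior|exact: nbhs_singleton].
Qed.

Lemma specialization_refl x : specialization x x.
Proof. exact/specializationP. Qed.

Lemma specialization_trans y x z :
  specialization x y -> specialization y z -> specialization x z.
Proof.
move=> /specializationP xy /specializationP yz.
by apply/specializationP => V oV Vx; apply: yz (xy _ oV Vx).
Qed.

Lemma specialization_anti : kolmogorov_space X ->
  forall x y, specialization x y -> specialization y x -> x = y.
Proof.
move=> T0 x y xy yx; apply/eqP/negPn/negP => /T0[A].
rewrite !inE => -[] [nA]; apply; first exact: specialization_nbhs xy nA.
exact: specialization_nbhs yx nA.
Qed.

Lemma closed_specialization A x y :
  closed A -> specialization x y -> A y -> A x.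
Proof.
move=> cA /specializationP xy Ay; apply: contrapT => nAx.
exact: (xy (~` A) (closed_openC cA) nAx).
Qed.

(** If the supremum were outside [A], the Scott open complement of [A] would meet [A]. *)
Lemma closed_directed_closure A : d_space X -> closed A ->
  directed (@specialization X) A -> exists! x, A = closure [set x].
Proof.
move=> [T0 dcX sX] cA dA; have [s [ub lub]] := dcX A dA.
have As : A s.
  apply: contrapT => nAs; have [_ so] := sX _ (closed_openC cA).
  by have [x []] := so A s dA (conj ub lub) nAs.
have AE : A = closure [set s].
  apply/seteqP; split=> [x /ub //|x xs].
  exact: closed_specialization cA xs As.
exists s; split=> // t At; apply: (specialization_anti T0).
  by rewrite /specialization -At.
by rewrite /specialization -AE At; exact: specialization_refl.
Qed.

Definition saturated_tail u a n : set X :=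
  [set x | specialization a x \/
           exists2 k, (n <= k)%N & specialization (u k) x].

Lemma saturated_tail_saturated u a n : saturated (saturated_tail u a n).
Proof.
move=> x y [ax|[k nk kx]] xy; first by left; apply: specialization_trans ax xy.
by right; exists k => //; apply: specialization_trans kx xy.
Qed.

Lemma saturated_tail_le u a m n : (m <= n)%N ->
  saturated_tail u a n `<=` saturated_tail u a m.
Proof.
move=> mn x [ax|[k nk kx]]; first by left.
by right; exists k => //; apply: leq_trans nk.
Qed.

(** A neighbourhood of the limit contains the up-sets of all but finitely many terms; each remaining
    up-set lies in every neighbourhood of its generator. *)
Lemma compact_saturated_tail u a n :
  u @ \oo --> a -> compact (saturated_tail u a n).
Proof.
move=> ua; apply/compact_near_coveringP => I F P FF cov.
have [|[V B] /= [nV FB] VB] := cov a; first by left; exact: specialization_refl.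
(* The interior makes [V] a neighbourhood of each late [u k], so [V] contains all points above
   it. *)
have [N _ uV] : \forall k \near \oo, V^° (u k) by exact/ua/nbhs_interior.
have FE : \forall i \near F, forall k : 'I_N, (n <= k)%N ->
    forall x, specialization (u k) x -> P i x.
  apply: filter_forall => k; have [nk|nk] := boolP (n <= k)%N; last first.
    by apply: nearW => i.
  have [|[W C] /= [nW FC] WC] := cov (u k).
    by right; exists k => //; exact: specialization_refl.
  apply: filterS FC => i Ci _ x ux.
  exact: (WC (x, i) (conj (specialization_nbhs ux nW) Ci)).
apply: filterS2 FB FE => i Bi Ei x [ax|[k nk kx]].
  exact: (VB (x, i) (conj (specialization_nbhs ax nV) Bi)).
have [kN|Nk] := ltnP k N; first exact: (Ei (Ordinal kN)).
exact: (VB (x, i) (conj (specialization_nbhs kx (uV _ Nk)) Bi)).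
Qed.

(* A point above infinitely many terms of [u] lies in every neighbourhood of
   the limit [a], hence is above [a]. *)
Lemma bigcap_saturated_tail u a x : u @ \oo --> a ->
  (forall n, saturated_tail u a n x) -> specialization a x.
Proof.
move=> ua ux; apply/specializationP => V oV Va.
have [N _ uV] : \forall k \near \oo, V (u k).
  by apply: ua; exact: open_nbhs_nbhs.
have [/specializationP|[k Nk /specializationP]] := ux N; apply => //.
exact: uV.
Qed.

Definition upper_bounds_in U : set (X * X) :=
  [set p | forall z, specialization p.1 z -> specialization p.2 z -> U z].

Lemma upper_bounds_in_open U :
  omega_well_filtered X -> coherent X -> sequential_space (X * X)%type ->
  open U -> open (upper_bounds_in U).
Proof.
move=> wf coh sq oU; rewrite -[X in open X]setCK; apply: closed_openC.
(* It remains to refute a sequence outside the set that converges to a point [(a, b)] of it. *)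
apply: sq => w [a b] nW wab Wab.
have ua : (fst \o w) @ \oo --> a by apply: cvg_comp wab _; exact: cvg_fst.
have vb : (snd \o w) @ \oo --> b by apply: cvg_comp wab _; exact: cvg_snd.
pose K n := saturated_tail (fst \o w) a n `&` saturated_tail (snd \o w) b n.
have Kle m n : (m <= n)%N -> K n `<=` K m.
  by move=> mn; apply: setISS; exact: saturated_tail_le.
have [|||z zK|_ [n _ <-] KU] := wf (range K) _ _ _ U oU.
- exact: card_image_le.
- split; first by exists (K 0%N); exists 0%N.
  move=> _ _ [m _ <-] [n _ <-]; exists (K (maxn m n)); split.
  + by exists (maxn m n).
  + by apply: Kle; exact: leq_maxl.
  + by apply: Kle; exact: leq_maxr.
- move=> _ [n _ <-]; split.
    apply: coh; split; try exact: saturated_tail_saturated;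
      exact: compact_saturated_tail.
  move=> x y [xl xr] xy.
  by split; [move: xl|move: xr] => /saturated_tail_saturated; exact.
(* A point of every [K n] is above both [a] and [b], hence in [U] by [Wab]. *)
- have zKn n : K n z by apply: zK; exists n.
  by apply: Wab => /=;
    [apply: bigcap_saturated_tail ua _|apply: bigcap_saturated_tail vb _]
    => n; have [] := zKn n.
(* Every common upper bound of the two coordinates of [w n] lies in [K n], hence in [U], against
   [nW n]. *)
- apply: (nW n) => z za zb; apply: KU; split; by right; exists n.
Qed.

(** Otherwise the closed complements of [U] and [V] would cover [A], so one of them would contain
    it. *)
Lemma irreducible_meet A U V : irreducible A -> open U -> open V ->
  A `&` U !=set0 -> A `&` V !=set0 -> exists z, [/\ A z, U z & V z].
Proof.
move=> [_ irr] oU oV [x [Ax Ux]] [y [Ay Vy]]; apply: contrapT => nz.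
have [| |z Az|h|h] := irr (~` U) (~` V).
- exact: open_closedC.
- exact: open_closedC.
- by apply: contrapT => /not_orP[/contrapT Uz /contrapT Vz]; apply: nz; exists z.
- exact: h Ux.
- exact: h Vy.
Qed.

End Specialization.

Theorem theorem4p1 (X : topologicalType)
  (X_wf : omega_well_filtered X) (X_coh : coherent X) (X_d : d_space X)
  (XX_seq : sequential_space (X * X)%type) :
  sober X.
Proof.
move=> A cA irrA; apply: closed_directed_closure => //.
split; first by case: irrA.
move=> x y Ax Ay; apply: contrapT => nz.
have oW := upper_bounds_in_open X_wf X_coh XX_seq (closed_openC cA).
have Wxy : upper_bounds_in (~` A) (x, y).
  by move=> z /= xz yz Az; apply: nz; exists z.
have [[V1 V2] /= [nV1 nV2] VW] := open_nbhs_nbhs (conj oW Wxy).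
have [||||z [Az V1z V2z]] := @irreducible_meet _ A V1^° V2^° irrA.
- exact: open_interior.
- exact: open_interior.
- by exists x.
- by exists y.
have /= Wzz := VW (z, z) (conj (interior_subset V1z) (interior_subset V2z)).
(* [z] is itself a common upper bound of the pair [(z, z)]. *)
by apply: Wzz Az => /=; exact: specialization_refl.
Qed.
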